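(* Let $k\ge 1$ and $n\ge 1$ be integers. The two definitions of $k$-compositions of $n$, by colored parts (a) and by internal zeros (b), are equivalent: the map which replaces, part by part and in order, each colored part $c_\ell$ (a positive integer $c$ with color $\ell\in\{1,\dots,k\}$) by the string of parts $$\underbrace{0+\cdots+0}_{\ell-1\text{ zeros}}+c$$ is a bijection from the set of $k$-compositions of $n$ in the sense of (a) to the set of $k$-compositions of $n$ in the sense of (b).
   Context: A composition of a positive integer $n$ is a finite ordered sequence of positive integers (parts) with sum $n$. For a positive integer $k$, a $k$-composition of $n$ is a composition of $n$ with one of the following modifications. (a) Colored parts: each part is assigned a color in $\{1,\dots,k\}$ (written as a subscript), except that the first part must have color 1. (b) Internal zeros: each (positive) part except the first may be immediately preceded by up to $k-1$ zeros; thus such an object is a finite sequence of nonnegative integers with sum $n$ whose first and last entries are positive and in which at most $k-1$ zeros occur between any two successive positive entries. *)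

(* Defs.v *)
From mathcomp Require Import all_boot.
From mathcomp Require Import classical_sets functions.

Set Implicit Arguments.
Unset Strict Implicit.
Unset Printing Implicit Defensive.

Local Open Scope nat_scope.

Definition is_composition (n : nat) (c : seq nat) : Prop :=
  all (fun x => 0 < x) c /\ sumn c = n.

(* A colored part c_l is the pair (c, l). With the default value 0, the last
   condition fails on the empty sequence, which has no first part; this
   excludes nothing when n > 0. *)
Definition colored_comp (k n : nat) : set (seq (nat * nat)) :=
  fun s => [/\ is_composition n (unzip1 s),
               all (fun l => 1 <= l <= k) (unzip2 s)
             & head 0 (unzip2 s) = 1].

(* With the default value 0, the conditions on the first and last entries
   fail on the empty sequence. In the last condition, the m zeros are those
   between the successive positive entries a and b. *)
Definition zero_comp (k n : nat) : set (seq nat) :=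
  fun s => [/\ sumn s = n,
               0 < head 0 s,
               0 < last 0 s
             & forall (s1 s2 : seq nat) (a b m : nat),
                 s = s1 ++ a :: nseq m 0 ++ b :: s2 ->
                 0 < a -> 0 < b -> m <= k.-1].

Definition expand_part (p : nat * nat) : seq nat :=
  rcons (nseq p.2.-1 0) p.1.

Definition expand (s : seq (nat * nat)) : seq nat :=
  flatten (map expand_part s).

(* Main.v *)
Require Import Defs.
From mathcomp Require Import all_boot.
From mathcomp Require Import classical_sets functions.

(** Expansion is undone by reading a sequence from left to right while counting
    zeros: a positive entry [c] met after [z] zeros since the last positive
    entry becomes the part [c] with color [z + 1].  This decoder [contract] is
    a left inverse of [expand] on positive parts with positive colors
    ([expandK]), whence injectivity, and a right inverse on sequences without
    trailing zeros ([contractK]), whence surjectivity once decoded sequences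
    are known to be colored compositions.

    What remains is that the bound on colors matches the bound on internal
    runs of zeros.  A run of [m] zeros between positive entries [a] and [b] is
    decoded into a part [b] of color [m + 1] ([contract_run]), so bounded
    colors give bounded runs; conversely every color but the first is one more
    than the length of such a run ([contract_color_le]). *)

(** The accumulator [z] is the number of zeros already read since the last
    positive entry; trailing zeros are dropped. *)
Fixpoint contract (z : nat) (s : seq nat) : seq (nat * nat) :=
  match s with
  | [::] => [::]
  | 0 :: s' => contract z.+1 s'
  | c :: s' => (c, z.+1) :: contract 0 s'
  end.

Lemma expand_cons p t : expand (p :: t) = nseq p.2.-1 0 ++ p.1 :: expand t.
Proof. by rewrite /expand /= /expand_part cat_rcons. Qed.

Lemma nseq_cat_cons (x : nat) z s : nseq z x ++ x :: s = nseq z.+1 x ++ s.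
Proof. by elim: z => //= z ->. Qed.

Lemma contract_nseq z m s : contract z (nseq m 0 ++ s) = contract (z + m) s.
Proof. by elim: m z => [|m IHm] z; rewrite ?addn0 //= IHm addSnnS. Qed.

Lemma contract_pos z b s :
  0 < b -> contract z (b :: s) = (b, z.+1) :: contract 0 s.
Proof. by case: b. Qed.

Lemma expandK t : all (fun x => 0 < x) (unzip1 t) ->
  all (fun l => 0 < l) (unzip2 t) -> contract 0 (expand t) = t.
Proof.
elim: t => [|[c l] t IHt] //= /andP[c_gt0 t1] /andP[l_gt0 t2].
by rewrite expand_cons contract_nseq contract_pos //= add0n prednK ?IHt.
Qed.

(** The zeros counted by the accumulator are restored in front of the
    sequence, which makes the statement inductive; the default value 1 covers
    the case where nothing is left to read, which then forces [z = 0]. *)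
Lemma contractK z s :
  0 < last 1 (nseq z 0 ++ s) -> expand (contract z s) = nseq z 0 ++ s.
Proof.
elim: s z => [|[|c] s IHs] z /=.
- case: z => // z; rewrite cats0 /=.
  by have -> : last 0 (nseq z 0) = 0 by elim: z.
- by rewrite nseq_cat_cons; apply: IHs.
- rewrite last_cat /= expand_cons /= => s_last; rewrite IHs //.
  by case: (s) s_last.
Qed.

Lemma sumn_contract z s : sumn (unzip1 (contract z s)) = sumn s.
Proof. by elim: s z => [|[|c] s IHs] z //=; rewrite IHs. Qed.

Lemma contract_part_gt0 z s : all (fun x => 0 < x) (unzip1 (contract z s)).
Proof. by elim: s z => [|[|c] s IHs] z /=. Qed.

Lemma contract_run z s1 a m b s2 : 0 < a -> 0 < b ->
  (b, m.+1) \in contract z (s1 ++ a :: nseq m 0 ++ b :: s2).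
Proof.
move=> a_gt0 b_gt0; elim: s1 z => [|[|c] s1 IHs1] z.
- by rewrite contract_pos // contract_nseq contract_pos // !in_cons eqxx orbT.
- exact: IHs1.
- by rewrite /= in_cons IHs1 orbT.
Qed.

(** The positive entry [a0] in front turns the zeros read before the first
    positive entry of [s] into an internal run as well. *)
Lemma contract_color_le k z a0 s : 0 < a0 ->
  (forall (s1 s2 : seq nat) (a b m : nat),
     a0 :: nseq z 0 ++ s = s1 ++ a :: nseq m 0 ++ b :: s2 ->
     0 < a -> 0 < b -> m < k) ->
  all (fun l => 1 <= l <= k) (unzip2 (contract z s)).
Proof.
elim: s z a0 => [|[|c] s IHs] z a0 a0_gt0 runs //=.
- apply: (IHs _ a0) => // s1 s2 a b m Es; apply: (runs s1 s2 a b m).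
  by rewrite nseq_cat_cons.
- rewrite (runs [::] s a0 c.+1 z) //=; apply: (IHs 0 c.+1) => //.
  move=> s1 s2 a b m /= Es; apply: (runs (a0 :: nseq z 0 ++ s1) s2 a b m).
  by rewrite Es /= -catA.
Qed.

Lemma colored_compK k n t : colored_comp k n t -> contract 0 (expand t) = t.
Proof.
case=> [[t1 _] t2 _]; apply: expandK _ t1 _.
by apply: sub_all t2 => l /andP[].
Qed.

Lemma expand_colored_comp k n t : 0 < k ->
  colored_comp k n t -> zero_comp k n (expand t).
Proof.
move=> k_gt0 ct; have tK := colored_compK _ _ _ ct.
case: ct => [[t1 sum_t] t2 head_t].
split.
- by rewrite -(sumn_contract 0) tK.
- case: t t1 head_t {sum_t t2 tK} => [|[c l] t] //= /andP[c_gt0 _] l1.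
  by rewrite expand_cons /= l1.
- case: t t1 head_t {sum_t t2 tK} => [|p t] //= t1 _.
  elim: t p t1 => [|q t IHt] p /= /andP[p_gt0 t1].
    by rewrite expand_cons last_cat.
  rewrite expand_cons last_cat /=; have := IHt q t1.
  by rewrite expand_cons !last_cat.
- move=> s1 s2 a b m Es a_gt0 b_gt0.
  have := contract_run 0 s1 a m b s2 a_gt0 b_gt0; rewrite -Es tK.
  move/(map_f snd)/(allP t2) => /= m_lt.
  by rewrite -ltnS prednK.
Qed.

Lemma contract_zero_comp k n s : 0 < k ->
  zero_comp k n s -> colored_comp k n (contract 0 s).
Proof.
move=> k_gt0 []; case: s => [|a0 s] // sum_s a0_gt0 last_s runs.
have sumE := sumn_contract 0 (a0 :: s); have gt0 := contract_part_gt0 0 (a0 :: s).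
rewrite contract_pos // in sumE gt0 *.
split=> //; first by rewrite /is_composition sumE.
rewrite /= k_gt0; apply: (contract_color_le _ 0 _ _ a0_gt0).
move=> s1 s2 a b m Es a_gt0 b_gt0.
by have := runs s1 s2 a b m Es a_gt0 b_gt0; rewrite -ltnS prednK.
Qed.

Theorem mainTheorem1 (k n : nat) (hk : (1 <= k)%N) (hn : (1 <= n)%N) :
  set_bij (colored_comp k n) (zero_comp k n) expand.
Proof.
split.
- by move=> t; apply: expand_colored_comp.
- move=> t u /set_mem/colored_compK tK /set_mem/colored_compK uK Etu.
  by rewrite -tK Etu uK.
- move=> s zs; exists (contract 0 s); first exact: contract_zero_comp.
  by case: zs => _ _ last_s _; apply: contractK; case: (s) last_s.
Qed.
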